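(* Let $R>0$, let $\overline{D}(0;R)=\{z\in\mathbb{C}:|z|\le R\}$, and suppose that $f:\overline{D}(0;R)\to\mathbb{C}$ is analytic and non-constant. Let $\alpha$, with $|\alpha|=R$, be a point of maximum or a point of minimum of $|f|$ on $\overline{D}(0;R)$. (a) If $\alpha$ is a point of maximum, then $f'(\alpha)\ne 0$. (b) If $\alpha$ is a point of minimum, then $f(\alpha)=0$ or $f'(\alpha)\ne 0$.
   Context: A function on an open set $\Omega\subset\mathbb{C}$ is analytic if around each $z_0\in\Omega$ it is given on some open disk centered at $z_0$ and contained in $\Omega$ by a convergent power series in $z-z_0$. For an arbitrary set $X\subset\mathbb{C}$, a function $f:X\to\mathbb{C}$ is analytic in $X$ if there exists an open set containing $X$ on which some extension of $f$ is analytic; $f'(\alpha)$ denotes the complex derivative at $\alpha$ of such an extension. *)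

(* Defs.v *)
From Stdlib Require Import Reals.
From Coquelicot Require Import Coquelicot.
Open Scope R_scope.

(* Coquelicot's uniform structure on C is that of R x R; it induces the usual
   topology, so [open], [is_pseries] and [is_derive] on C have their standard
   complex-analytic meaning. Disks are written with the modulus. *)

Definition analytic_on_open (U : C -> Prop) (f : C -> C) : Prop :=
  open U /\
  forall z0 : C, U z0 ->
    exists (rho : R) (a : nat -> C),
      0 < rho /\
      forall z : C, Cmod (z - z0)%C < rho ->
        U z /\ is_pseries a (z - z0)%C (f z).

(* A function X -> C is represented by a total function C -> C of which only
   the values on X are ever used. *)
Definition analytic_extension (X : C -> Prop) (f : C -> C)
    (U : C -> Prop) (g : C -> C) : Prop :=
  (forall z, X z -> U z) /\
  (forall z, X z -> g z = f z) /\
  analytic_on_open U g.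

Definition analytic_in (X : C -> Prop) (f : C -> C) : Prop :=
  exists (U : C -> Prop) (g : C -> C), analytic_extension X f U g.

(* "f'(alpha) = l" for f analytic in X: l is the complex derivative at alpha of
   the analytic extensions of f, whichever extension is chosen. *)
Definition is_derive_in (X : C -> Prop) (f : C -> C) (alpha l : C) : Prop :=
  analytic_in X f /\
  forall (U : C -> Prop) (g : C -> C),
    analytic_extension X f U g -> is_derive g alpha l.

Definition closed_disk (r : R) (z : C) : Prop := Cmod z <= r.

Definition constant_on (X : C -> Prop) (f : C -> C) : Prop :=
  exists c : C, forall z, X z -> f z = c.

Definition is_max_point (X : C -> Prop) (u : C -> R) (alpha : C) : Prop :=
  X alpha /\ forall z, X z -> u z <= u alpha.

Definition is_min_point (X : C -> Prop) (u : C -> R) (alpha : C) : Prop :=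
  X alpha /\ forall z, X z -> u alpha <= u z.

(* Main.v *)
Require Import Defs.
From Stdlib Require Import Reals Lra Lia Classical Wf_nat.
From Coquelicot Require Import Coquelicot.
Open Scope R_scope.

(** Suppose [f] has a vanishing derivative at the boundary point [alpha]. Since
    [f] is not constant, the identity theorem gives an expansion
    [f (alpha + w) = f alpha + b w^k + O(w^(k+1))] with [b <> 0], and now
    [k >= 2]. The vectors pointing from [alpha] into the disk fill a half-plane,
    an angle of [pi]; raising to the power [k] opens it to an angle of at least
    [2 pi], so [b w^k] can be given essentially any argument while
    [alpha + w] stays in the disk. For a given [c <> 0] there is thus a point
    [z] of the disk, close to [alpha], with
    [Re (c (f z - f alpha)) > |f z - f alpha|^2]
    (lemma [leading_term_escapes]). On the other hand
    [|f z|^2 = |f alpha|^2 + 2 Re (conj (f alpha) (f z - f alpha)) + |f z - f alpha|^2],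
    so this inequality contradicts maximality of [|f alpha|] when
    [c = conj (f alpha)] and minimality when [c = - conj (f alpha)]. The choice
    requires [f alpha <> 0], which at a maximum point is automatic for a
    non-constant [f].

    All local information comes from one estimate, the Taylor remainder bound
    [taylor_remainder]: it yields the leading term, the isolation of the points
    where a given value is taken (hence the identity theorem along segments,
    [identity_on_segment]), the derivative [pseries_derive], and the fact that
    the derivative at a boundary point is determined by the values of [f] on
    the disk alone ([boundary_derive_in]), as [is_derive_in] asks. *)

(** * Taylor polynomials of a convergent power series *)

Definition taylor_poly (a : nat -> C) (k : nat) (w : C) : C :=
  sum_n (fun n => (a n * w ^ n)%C) k.

Lemma taylor_poly_S a k w : taylor_poly a (S k) w = (taylor_poly a k w + a (S k) * w ^ S k)%C.
Proof. unfold taylor_poly. now rewrite sum_Sn. Qed.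

Lemma pseries_partial_sum (a : nat -> C) (w : C) (n : nat) :
  sum_n (fun k : nat => scal (pow_n w k) (a k)) n = taylor_poly a n w.
Proof.
  apply sum_n_ext; intros k; change (pow_n w k * a k = a k * w ^ k)%C.
  rewrite Cmult_comm; f_equal.
Qed.

Lemma taylor_poly_cvg (a : nat -> C) (w l : C) :
  is_pseries a w l ->
  forall eps : posreal, exists N, forall n, (N <= n)%nat ->
    Cmod (taylor_poly a n w - l) < eps.
Proof.
  intros H eps.
  assert (H1 := proj1 (filterlim_locally_ball_norm _ _) H eps).
  destruct H1 as [N HN]; exists N; intros n Hn.
  specialize (HN n Hn); rewrite pseries_partial_sum in HN. exact HN.
Qed.

Lemma taylor_poly_bounded (a : nat -> C) (w l : C) :
  is_pseries a w l -> exists M, forall n, Cmod (taylor_poly a n w) <= M.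
Proof.
  intros H.
  destruct (filterlim_bounded _ (ex_intro _ l H)) as [M HM].
  exists M; intros n; specialize (HM n); rewrite pseries_partial_sum in HM; exact HM.
Qed.

(** Consecutive partial sums are bounded and differ by one term. *)
Lemma pseries_terms_bounded (a : nat -> C) (w l : C) :
  is_pseries a w l -> exists M, forall n, Cmod (a n * w ^ n) <= M.
Proof.
  intros H; destruct (taylor_poly_bounded a w l H) as [M HM].
  exists (M + M); intros [|n].
  - specialize (HM 0%nat). unfold taylor_poly in HM; rewrite sum_O in HM.
    pose proof (Cmod_ge_0 (a 0%nat * w ^ 0)). lra.
  - replace (a (S n) * w ^ S n)%C with (taylor_poly a (S n) w + - taylor_poly a n w)%C
      by (rewrite taylor_poly_S; ring).
    eapply Rle_trans; [apply Cmod_triangle|]. rewrite Cmod_opp.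
    apply Rplus_le_compat; apply HM.
Qed.

(** The terms are bounded at a radius [s] inside the disk of convergence, so for
    [|w| <= s/2] the tail after degree [k] is dominated by a geometric series of
    ratio [q = |w|/s <= 1/2], whose sum is of order [q^(k+1)]. *)
Lemma taylor_remainder (a : nat -> C) (rho : R) (F : C -> C) :
  0 < rho -> (forall w, Cmod w < rho -> is_pseries a w (F w)) ->
  forall k, exists M d, 0 < M /\ 0 < d /\
    forall w, Cmod w < d -> Cmod (F w - taylor_poly a k w) <= M * Cmod w ^ S k.
Proof.
  intros hrho HF k.
  set (s := rho / 2). assert (hs : 0 < s) by (unfold s; lra).
  assert (hsm : Cmod (RtoC s) = s) by (rewrite Cmod_R; apply Rabs_pos_eq; lra).
  destruct (pseries_terms_bounded a (RtoC s) (F (RtoC s))) as [B HB].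
  { apply HF. rewrite hsm; unfold s; lra. }
  assert (hB : 0 <= B) by (eapply Rle_trans; [apply Cmod_ge_0 | apply (HB 0%nat)]).
  exists (2 * B * (/ s) ^ S k + 1), (s / 2).
  assert (hsk : 0 < (/ s) ^ S k) by (apply pow_lt, Rinv_0_lt_compat, hs).
  split; [nra|]. split; [lra|]. intros w hw.
  pose proof (Cmod_ge_0 w) as hw0.
  set (q := Cmod w * / s).
  assert (hq0 : 0 <= q) by (apply Rmult_le_pos; [lra | apply Rlt_le, Rinv_0_lt_compat, hs]).
  assert (hq : q <= / 2).
  { unfold q. apply (Rmult_le_reg_r s); [lra|]. rewrite Rmult_assoc, Rinv_l; lra. }
  assert (Hterm : forall n, Cmod (a n * w ^ n) <= B * q ^ n).
  { intros n. unfold q. rewrite Rpow_mult_distr, pow_inv.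
    specialize (HB n). rewrite Cmod_mult, Cmod_pow, hsm in HB.
    rewrite Cmod_mult, Cmod_pow.
    assert (0 < s ^ n) by (apply pow_lt, hs).
    apply (Rmult_le_reg_r (s ^ n)); [lra|].
    replace (B * (Cmod w ^ n * / s ^ n) * s ^ n) with (B * Cmod w ^ n) by (field; lra).
    pose proof (pow_le _ n hw0). nra. }
  (* The subtracted power makes the geometric bound inductive: passing from [m]
     to [m + 1] amounts to [q <= 1/2]. *)
  assert (Hpart : forall m,
    Cmod (taylor_poly a (k + m) w - taylor_poly a k w) <= 2 * B * (q ^ S k - q ^ S (k + m))).
  { induction m as [|m IH].
    - rewrite Nat.add_0_r.
      replace (taylor_poly a k w - taylor_poly a k w)%C with (RtoC 0) by ring.
      rewrite Cmod_0; lra.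
    - rewrite Nat.add_succ_r, taylor_poly_S.
      replace (taylor_poly a (k + m) w + a (S (k + m)) * w ^ S (k + m) - taylor_poly a k w)%C
        with ((taylor_poly a (k + m) w - taylor_poly a k w)
              + a (S (k + m)) * w ^ S (k + m))%C by ring.
      eapply Rle_trans; [apply Cmod_triangle|].
      specialize (Hterm (S (k + m))).
      assert (0 <= B * q ^ S (k + m)) by (apply Rmult_le_pos; [lra | apply pow_le, hq0]).
      change (q ^ S (S (k + m))) with (q * q ^ S (k + m)). nra. }
  apply Rle_trans with (2 * B * (/ s) ^ S k * Cmod w ^ S k).
  2: { pose proof (pow_le _ (S k) hw0). nra. }
  replace (2 * B * (/ s) ^ S k * Cmod w ^ S k) with (2 * B * q ^ S k)
    by (unfold q; rewrite Rpow_mult_distr; ring).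
  apply le_epsilon; intros eps heps.
  assert (hwr : Cmod w < rho) by (unfold s in hw; lra).
  destruct (taylor_poly_cvg a w (F w) (HF w hwr) (mkposreal eps heps)) as [N HN].
  specialize (HN (k + N)%nat ltac:(lia)). simpl in HN.
  replace (F w - taylor_poly a k w)%C
    with ((taylor_poly a (k + N) w - taylor_poly a k w)
          + - (taylor_poly a (k + N) w - F w))%C by ring.
  eapply Rle_trans; [apply Cmod_triangle|]. rewrite Cmod_opp.
  specialize (Hpart N).
  assert (0 <= B * q ^ S (k + N)) by (apply Rmult_le_pos; [lra | apply pow_le, hq0]).
  lra.
Qed.

(** * Leading terms and the identity theorem *)

Lemma Cmod_minus_small_eq (u v : C) :
  (forall eps, 0 < eps -> Cmod (u - v) <= eps) -> u = v.
Proof.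
  intros H.
  assert (Z : Cmod (u - v) = 0).
  { apply Rle_antisym; [|apply Cmod_ge_0].
    apply le_epsilon; intros eps heps. rewrite Rplus_0_l. auto. }
  apply Cmod_eq_0 in Z.
  replace u with (u - v + v)%C by ring. rewrite Z; ring.
Qed.

Lemma pseries_const_sum (a : nat -> C) (w l : C) :
  is_pseries a w l -> (forall n, (1 <= n)%nat -> (a n * w ^ n)%C = RtoC 0) -> l = a 0%nat.
Proof.
  intros H Ha.
  assert (E : forall n, taylor_poly a n w = a 0%nat).
  { induction n as [|n IH].
    - unfold taylor_poly; rewrite sum_O. simpl. ring.
    - rewrite taylor_poly_S, IH, Ha by lia. ring. }
  symmetry; apply Cmod_minus_small_eq; intros eps heps.
  destruct (taylor_poly_cvg _ _ _ H (mkposreal eps heps)) as [N HN].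
  specialize (HN N (le_n N)); rewrite E in HN; simpl in HN. lra.
Qed.

Lemma pseries_at_0 (a : nat -> C) (l : C) : is_pseries a (RtoC 0) l -> l = a 0%nat.
Proof.
  intros H; apply (pseries_const_sum _ _ _ H).
  intros [|n] hn; [lia|]. simpl. ring.
Qed.

Lemma taylor_poly_leading (a : nat -> C) (k : nat) (w : C) :
  (1 <= k)%nat -> (forall j, (1 <= j < k)%nat -> a j = RtoC 0) ->
  taylor_poly a k w = (a 0%nat + a k * w ^ k)%C.
Proof.
  destruct k as [|k]; [lia|]; intros _ Ha.
  rewrite taylor_poly_S; f_equal.
  assert (E : forall n, (n <= k)%nat -> taylor_poly a n w = a 0%nat).
  { induction n as [|n IH]; intros hn.
    - unfold taylor_poly; rewrite sum_O. simpl. ring.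
    - rewrite taylor_poly_S, IH, (Ha (S n)) by lia. ring. }
  now apply E.
Qed.

(** When all coefficients of positive index vanish the sum is constant;
    otherwise the Taylor polynomial up to the first nonzero one has only two
    terms. *)
Lemma constant_or_leading_term (a : nat -> C) (rho : R) (F : C -> C) :
  0 < rho -> (forall w, Cmod w < rho -> is_pseries a w (F w)) ->
  (forall w, Cmod w < rho -> F w = a 0%nat) \/
  exists k M d, (1 <= k)%nat /\ a k <> RtoC 0 /\ 0 < M /\ 0 < d /\
    forall w, Cmod w < d -> Cmod (F w - (a 0%nat + a k * w ^ k)) <= M * Cmod w ^ S k.
Proof.
  intros hrho HF.
  destruct (classic (exists k, (1 <= k)%nat /\ a k <> RtoC 0)) as [Hex|Hno].
  - right.
    destruct (dec_inh_nat_subset_has_unique_least_element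
                (fun k => (1 <= k)%nat /\ a k <> RtoC 0) (fun k => classic _) Hex)
      as [k [[[hk hak] hmin] _]].
    destruct (taylor_remainder a rho F hrho HF k) as [M [d [hM [hd HT]]]].
    assert (hlow : forall j, (1 <= j < k)%nat -> a j = RtoC 0).
    { intros j hj; apply NNPP; intros hne.
      specialize (hmin j (conj (proj1 hj) hne)); lia. }
    exists k, M, d. repeat (split; [assumption|]).
    intros w hw; rewrite <- taylor_poly_leading by assumption. now apply HT.
  - left; intros w hw.
    apply (pseries_const_sum a w _ (HF w hw)); intros n hn.
    replace (a n) with (RtoC 0); [ring|].
    apply NNPP; intros hne; apply Hno; exists n; auto.
Qed.

(** Zeros are isolated: near the centre a nonzero term [a_k w^k] outweighs a
    remainder of order [k + 1]. *)
Lemma accumulating_value_constant (a : nat -> C) (rho : R) (F : C -> C) (c : C) :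
  0 < rho -> (forall w, Cmod w < rho -> is_pseries a w (F w)) ->
  (forall d, 0 < d -> exists w, 0 < Cmod w < d /\ F w = c) ->
  forall w, Cmod w < rho -> F w = c.
Proof.
  intros hrho HF Hacc.
  assert (ha0 : a 0%nat = c).
  { destruct (taylor_remainder a rho F hrho HF 0) as [M [d [hM [hd HT]]]].
    symmetry; apply Cmod_minus_small_eq; intros eps heps.
    destruct (Hacc (Rmin d (eps / M))) as [w [[hw0 hw] hFw]].
    { apply Rmin_pos; [lra | now apply Rdiv_lt_0_compat]. }
    specialize (HT w (Rlt_le_trans _ _ _ hw (Rmin_l _ _))).
    unfold taylor_poly in HT; rewrite sum_O, hFw in HT; simpl in HT.
    replace (a 0%nat * 1)%C with (a 0%nat) in HT by ring.
    pose proof (Rlt_le_trans _ _ _ hw (Rmin_r _ _)) as hw'.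
    apply (Rmult_lt_compat_r M) in hw'; [|lra].
    replace (eps / M * M) with eps in hw' by (field; lra). lra. }
  destruct (constant_or_leading_term a rho F hrho HF)
    as [Hc | [k [M [d [hk [hak [hM [hd HT]]]]]]]].
  { intros w hw; rewrite <- ha0; auto. }
  exfalso.
  assert (hak' := proj1 (Cmod_gt_0 _) hak).
  destruct (Hacc (Rmin d (Cmod (a k) / M))) as [w [[hw0 hw] hFw]].
  { apply Rmin_pos; [lra | now apply Rdiv_lt_0_compat]. }
  specialize (HT w (Rlt_le_trans _ _ _ hw (Rmin_l _ _))).
  rewrite hFw, ha0 in HT.
  replace (c - (c + a k * w ^ k))%C with (- (a k * w ^ k))%C in HT by ring.
  rewrite Cmod_opp, Cmod_mult, Cmod_pow in HT.
  pose proof (Rlt_le_trans _ _ _ hw (Rmin_r _ _)) as hw'.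
  apply (Rmult_lt_compat_r M) in hw'; [|lra].
  replace (Cmod (a k) / M * M) with (Cmod (a k)) in hw' by (field; lra).
  assert (0 < Cmod w ^ k) by now apply pow_lt.
  simpl in HT. nra.
Qed.

(** The identity theorem reduces to the segment from [p] to [p + v], where
    connectedness is completeness of the reals: let [s] be the supremum of the
    parameters up to which [g] is [c]. The value [c] accumulates at the point of
    parameter [s], so [g = c] around that point, and [s < 1] is impossible. *)
Lemma identity_on_segment (U : C -> Prop) (g : C -> C) (p v c : C) :
  analytic_on_open U g -> (forall t, 0 <= t <= 1 -> U (p + t * v)%C) ->
  (exists d, 0 < d /\ forall z, Cmod (z - p) < d -> g z = c) ->
  g (p + v)%C = c.
Proof.
  intros [_ Hg] HU [d [hd Hd]].
  destruct (classic (v = RtoC 0)) as [->|hv].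
  { apply Hd. replace (p + 0 - p)%C with (RtoC 0) by ring. rewrite Cmod_0; lra. }
  apply (proj1 (Cmod_gt_0 _)) in hv.
  assert (dist : forall s t : R, Cmod (p + t * v - (p + s * v)) = Rabs (t - s) * Cmod v).
  { intros s t. replace (p + t * v - (p + s * v))%C with (RtoC (t - s) * v)%C
      by (rewrite RtoC_minus; ring).
    now rewrite Cmod_mult, Cmod_R. }
  set (S := fun s => 0 <= s <= 1 /\ forall t, 0 <= t <= s -> g (p + t * v)%C = c).
  destruct (completeness S) as [s [hub hleast]].
  { exists 1; intros x [[_ hx] _]; exact hx. }
  { exists 0; split; [lra|]. intros t ht. replace t with 0 by lra.
    apply Hd. replace (p + 0 * v - p)%C with (RtoC 0) by ring. rewrite Cmod_0; lra. }
  assert (hs1 : s <= 1) by (apply hleast; intros x [[_ hx] _]; exact hx).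
  (* Without [0 < s] there would be no points of the segment before parameter [s]
     from which the value [c] accumulates there. *)
  assert (hspos : 0 < s).
  { set (e := Rmin 1 (d / Cmod v / 2)).
    assert (hdv : 0 < d / Cmod v) by now apply Rdiv_lt_0_compat.
    assert (he : 0 < e) by (apply Rmin_pos; lra).
    apply Rlt_le_trans with e; [exact he|]. apply hub.
    assert (e <= 1) by apply Rmin_l.
    assert (e <= d / Cmod v / 2) by apply Rmin_r.
    split; [lra|]. intros t ht; apply Hd.
    specialize (dist 0 t). replace (p + 0 * v)%C with p in dist by ring.
    rewrite dist, Rabs_pos_eq by lra.
    apply (Rmult_lt_reg_r (/ Cmod v)); [now apply Rinv_0_lt_compat|].
    rewrite Rmult_assoc, Rinv_r by lra. fold (Rdiv d (Cmod v)). lra. }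
  assert (hlow : forall t, 0 <= t < s -> g (p + t * v)%C = c).
  { intros t ht. apply NNPP; intros hne.
    assert (s <= t); [|lra]. apply hleast; intros x [hx Hx].
    destruct (Rle_lt_dec x t); [assumption|].
    exfalso; apply hne, Hx; lra. }
  destruct (Hg (p + s * v)%C) as [rho [a [hrho Ha]]]; [apply HU; lra|].
  assert (Hc : forall z, Cmod (z - (p + s * v)) < rho -> g z = c).
  { intros z hz.
    pose proof (accumulating_value_constant a rho (fun w => g (p + s * v + w)%C) c hrho)
      as Hacc.
    replace z with (p + s * v + (z - (p + s * v)))%C by ring.
    apply Hacc; [| |exact hz].
    - intros w hw.
      replace w with (p + s * v + w - (p + s * v))%C at 1 by ring.
      apply Ha. replace (p + s * v + w - (p + s * v))%C with w by ring. exact hw.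
    - intros e he. set (h := Rmin s (e / Cmod v / 2)).
      assert (hev : 0 < e / Cmod v) by now apply Rdiv_lt_0_compat.
      assert (hh : 0 < h) by (apply Rmin_pos; lra).
      assert (h <= s) by apply Rmin_l.
      assert (hhe : h <= e / Cmod v / 2) by apply Rmin_r.
      exists (RtoC (- h) * v)%C. split.
      + rewrite Cmod_mult, Cmod_R, Rabs_Ropp, Rabs_pos_eq by lra.
        split; [now apply Rmult_lt_0_compat|].
        apply (Rmult_lt_reg_r (/ Cmod v)); [now apply Rinv_0_lt_compat|].
        rewrite Rmult_assoc, Rinv_r by lra. fold (Rdiv e (Cmod v)). lra.
      + replace (p + s * v + (- h)%R * v)%C with (p + (s - h)%R * v)%C
          by (rewrite RtoC_minus, RtoC_opp; ring).
        apply hlow; lra. }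
  assert (hs : s = 1).
  { apply Rle_antisym; [exact hs1|]. apply Rnot_lt_le; intros hlt.
    set (e := Rmin (1 - s) (rho / Cmod v / 2)).
    assert (hrv : 0 < rho / Cmod v) by now apply Rdiv_lt_0_compat.
    assert (he : 0 < e) by (apply Rmin_pos; lra).
    assert (e <= 1 - s) by apply Rmin_l.
    assert (e <= rho / Cmod v / 2) by apply Rmin_r.
    assert (s + e <= s); [|lra]. apply hub.
    split; [lra|]. intros t ht.
    destruct (Rlt_le_dec t s) as [hts|hts]; [apply hlow; lra|].
    apply Hc. rewrite dist, Rabs_pos_eq by lra.
    apply (Rmult_lt_reg_r (/ Cmod v)); [now apply Rinv_0_lt_compat|].
    rewrite Rmult_assoc, Rinv_r by lra. fold (Rdiv rho (Cmod v)). lra. }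
  apply Hc. rewrite hs. replace (p + v - (p + 1 * v))%C with (RtoC 0) by ring.
  rewrite Cmod_0; exact hrho.
Qed.

(** * Directions pointing into the disk *)

Lemma de_moivre (x : R) (k : nat) :
  ((cos x, sin x) ^ k)%C = (cos (INR k * x), sin (INR k * x)).
Proof.
  induction k as [|k IH].
  - simpl. rewrite Rmult_0_l, cos_0, sin_0. reflexivity.
  - rewrite Cpow_S, IH, S_INR.
    replace ((INR k + 1) * x) with (x + INR k * x) by ring.
    rewrite cos_plus, sin_plus. unfold Cmult; simpl. f_equal; ring.
Qed.

(** The angles [0] and [+- 2 pi/(3 k)] have modulus at most [pi/3] because
    [k >= 2], while the [k]-th powers of the corresponding unit vectors are the
    three cube roots of unity. The triangle with vertices [b], [b omega],
    [b omega^2] is centred at the origin, so one vertex has positive real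
    part. *)
Lemma power_reaches_half_plane (b : C) (k : nat) :
  (2 <= k)%nat -> b <> RtoC 0 ->
  exists u : C, Cmod u = 1 /\ 1 / 2 <= Re u /\ 0 < Re (b * u ^ k)%C.
Proof.
  intros hk hb.
  assert (hK : 2 <= INR k) by (apply (le_INR 2), hk).
  pose proof PI_RGT_0 as hpi.
  assert (Hunit : forall x, Cmod (cos x, sin x) = 1).
  { intros x. unfold Cmod; simpl. rewrite !Rmult_1_r.
    rewrite Rplus_comm. change (sqrt (Rsqr (sin x) + Rsqr (cos x)) = 1).
    rewrite sin2_cos2. apply sqrt_1. }
  set (y := 2 * (PI / 3) / INR k).
  assert (hy : INR k * y = 2 * (PI / 3)) by (unfold y; field; lra).
  assert (hcos : 1 / 2 <= cos y).
  { rewrite <- cos_PI3. apply cos_decr_1; try nra. }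
  assert (hs : 0 < sqrt 3) by (apply sqrt_lt_R0; lra).
  assert (hc3 : cos (2 * (PI / 3)) = -1 / 2) by apply cos_2PI3.
  assert (hs3 : sin (2 * (PI / 3)) = sqrt 3 / 2) by apply sin_2PI3.
  destruct b as [b1 b2].
  destruct (Rlt_le_dec 0 b1) as [h1|h1].
  - exists (cos 0, sin 0). split; [apply Hunit|].
    rewrite de_moivre, Rmult_0_r, cos_0, sin_0. simpl. lra.
  - destruct (Rle_lt_dec b2 0) as [h2|h2].
    + exists (cos y, sin y). split; [apply Hunit|]. split; [exact hcos|].
      rewrite de_moivre, hy, hc3, hs3. simpl.
      destruct (Req_dec b1 0) as [e1|e1]; [|nra].
      assert (b2 <> 0) by (intros e2; apply hb; now rewrite e1, e2).
      nra.
    + exists (cos (- y), sin (- y)). split; [apply Hunit|].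
      split; [simpl; rewrite cos_neg; exact hcos|].
      rewrite de_moivre. replace (INR k * - y) with (- (2 * (PI / 3))) by lra.
      rewrite cos_neg, sin_neg, hc3, hs3. simpl. nra.
Qed.

(** For a unit vector [u] one has [|1 - t u|^2 = 1 - 2 t Re u + t^2], and
    [Re u >= 1/2] bounds this by [1 - t + t^2 <= 1]. *)
Lemma chord_in_disk (p u : C) (t : R) :
  Cmod u = 1 -> 1 / 2 <= Re u -> 0 <= t <= 1 -> Cmod (p + t * (- p * u)) <= Cmod p.
Proof.
  intros hu hre ht.
  replace (p + t * (- p * u))%C with (p * (1 - t * u))%C by ring.
  rewrite Cmod_mult.
  assert (Cmod (1 - t * u) <= 1).
  { pose proof (Cmod2_alt (1 - t * u)%C) as H.
    pose proof (Cmod2_alt u) as H2. rewrite hu in H2.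
    destruct u as [x y]; simpl in *.
    pose proof (Cmod_ge_0 (1 - t * (x, y))). nra. }
  pose proof (Cmod_ge_0 p). nra.
Qed.

(** Move from [p] along [w = - t p u], with [u] chosen so that
    [e = Re (c b (- p u)^k) > 0]. Then [Re (c G w) >= t^k e - O(t^(k+1))], while
    [|G w|^2 = O(t^(2 k))] is also [O(t^(k+1))]; hence a small [t] suffices. *)
Lemma leading_term_escapes (p b c : C) (k : nat) (M d : R) (G : C -> C) :
  p <> RtoC 0 -> b <> RtoC 0 -> c <> RtoC 0 -> (2 <= k)%nat -> 0 < M -> 0 < d ->
  (forall w, Cmod w < d -> Cmod (G w - b * w ^ k) <= M * Cmod w ^ S k) ->
  exists w, Cmod (p + w) <= Cmod p /\ Cmod (G w) ^ 2 < Re (c * G w).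
Proof.
  intros hp hb hc hk hM hd HG.
  destruct (power_reaches_half_plane (c * b * (- p) ^ k)%C k hk) as [u [hu [hre hpos]]].
  { repeat apply Cmult_neq_0; auto. apply Cpow_nz. intros e; apply hp.
    replace p with (- - p)%C by ring. rewrite e; ring. }
  set (r := Cmod p). assert (hr : 0 < r) by now apply Cmod_gt_0.
  set (v := (- p * u)%C).
  assert (hv : Cmod v = r) by (unfold v; rewrite Cmod_mult, Cmod_opp, hu; unfold r; ring).
  set (e := Re (c * b * (- p) ^ k * u ^ k)%C) in *.
  set (E := M * r ^ S k).
  assert (hE : 0 < E) by (apply Rmult_lt_0_compat; [lra | now apply pow_lt]).
  set (A := Cmod b * r ^ k + E).
  assert (hA : 0 < A).
  { unfold A. pose proof (Cmod_ge_0 b). assert (0 < r ^ k) by now apply pow_lt. nra. }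
  pose proof (Cmod_ge_0 c) as hc0.
  (* [K t^(k+1)] bounds all error terms together, so that [t K < e] is the
     condition on the step. *)
  set (K := Cmod c * E + A ^ 2).
  assert (hK : 0 < K) by (unfold K; nra).
  set (t := Rmin 1 (Rmin (d / (2 * r)) (e / (2 * K)))).
  assert (ht : 0 < t).
  { repeat apply Rmin_pos; try lra; apply Rdiv_lt_0_compat; lra. }
  assert (ht1 : t <= 1) by apply Rmin_l.
  assert (htd : t * r < d).
  { assert (h : t <= d / (2 * r)) by (eapply Rle_trans; [apply Rmin_r | apply Rmin_l]).
    apply (Rmult_le_compat_r r) in h; [|lra].
    replace (d / (2 * r) * r) with (d / 2) in h by (field; lra). lra. }
  assert (htK : t * K < e).
  { assert (h : t <= e / (2 * K)) by (eapply Rle_trans; [apply Rmin_r | apply Rmin_r]).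
    apply (Rmult_le_compat_r K) in h; [|lra].
    replace (e / (2 * K) * K) with (e / 2) in h by (field; lra). lra. }
  clearbody t.
  set (w := (t * v)%C).
  assert (hw : Cmod w = t * r).
  { unfold w; rewrite Cmod_mult, Cmod_R, Rabs_pos_eq, hv; [reflexivity | lra]. }
  exists w. split; [apply chord_in_disk; auto; lra|].
  specialize (HG w ltac:(lra)). rewrite hw, Rpow_mult_distr in HG.
  set (D := (G w - b * w ^ k)%C) in *.
  assert (hGw : G w = (b * w ^ k + D)%C) by (unfold D; ring).
  assert (htk : 0 < t ^ k) by now apply pow_lt.
  assert (hD : Cmod D <= t ^ k * t * E) by (unfold E; simpl in *; lra).
  assert (hmain : Re (c * (b * w ^ k)) = t ^ k * e).
  { replace (c * (b * w ^ k))%C with (RtoC (t ^ k) * (c * b * (- p) ^ k * u ^ k))%C.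
    - unfold e. set (z := (c * b * (- p) ^ k * u ^ k)%C). destruct z as [z1 z2]. simpl. ring.
    - unfold w, v. rewrite !Cpow_mult_l, RtoC_pow. ring. }
  assert (hlin : t ^ k * e - Cmod c * (t ^ k * t * E) <= Re (c * G w)).
  { rewrite hGw. replace (c * (b * w ^ k + D))%C with (c * (b * w ^ k) + c * D)%C by ring.
    replace (Re (c * (b * w ^ k) + c * D)) with (Re (c * (b * w ^ k)) + Re (c * D))
      by reflexivity.
    rewrite hmain. pose proof (re_le_Cmod (c * D)) as h. rewrite Cmod_mult in h.
    pose proof (Rle_abs (- Re (c * D))) as h'. rewrite Rabs_Ropp in h'.
    assert (Cmod c * Cmod D <= Cmod c * (t ^ k * t * E)) by now apply Rmult_le_compat_l.
    lra. }
  assert (hmod : Cmod (G w) <= t ^ k * A).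
  { rewrite hGw. eapply Rle_trans; [apply Cmod_triangle|].
    rewrite Cmod_mult, Cmod_pow, hw, Rpow_mult_distr. unfold A.
    assert (t ^ k * t * E <= t ^ k * E).
    { apply Rmult_le_compat_r; [lra|].
      rewrite <- (Rmult_1_r (t ^ k)) at 2. apply Rmult_le_compat_l; lra. }
    lra. }
  assert (htk1 : t ^ k <= t).
  { destruct k as [|k]; [lia|]. simpl.
    assert (t ^ k <= 1 ^ k) by (apply pow_incr; lra). rewrite pow1 in *. nra. }
  pose proof (Cmod_ge_0 (G w)) as hG0.
  assert (hsq : Cmod (G w) ^ 2 <= t ^ k * t * A ^ 2).
  { apply Rle_trans with ((t ^ k * A) ^ 2); [apply pow_incr; lra|].
    replace ((t ^ k * A) ^ 2) with (t ^ k * (t ^ k) * A ^ 2) by ring.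
    apply Rmult_le_compat_r; [nra|]. nra. }
  assert (t ^ k * (t * K) < t ^ k * e) by now apply Rmult_lt_compat_l.
  unfold K in *. nra.
Qed.

(** * The derivative at a boundary point *)

Lemma pseries_derive (a : nat -> C) (rho : R) (g : C -> C) (p : C) :
  0 < rho -> (forall w, Cmod w < rho -> is_pseries a w (g (p + w)%C)) ->
  is_derive g p (a 1%nat).
Proof.
  intros hrho Ha.
  destruct (taylor_remainder a rho (fun w => g (p + w)%C) hrho Ha 1) as [M [d [hM [hd HT]]]].
  split; [apply is_linear_scal_l|].
  intros x hx eps.
  pose proof (is_filter_lim_locally_unique (V := AbsRing_NormedModule C_AbsRing) p x hx) as e.
  rewrite <- e; clear x hx e.
  assert (hpos : 0 < Rmin d (eps / M)).
  { apply Rmin_pos; [lra | apply Rdiv_lt_0_compat; [apply cond_pos | lra]]. }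
  exists (mkposreal _ hpos).
  change (forall y : C, Cmod (y - p) < Rmin d (eps / M) ->
    Cmod (g y - g p - (y - p) * a 1%nat) <= eps * Cmod (y - p)).
  intros y hy.
  specialize (HT (y - p)%C (Rlt_le_trans _ _ _ hy (Rmin_l _ _))).
  assert (h0 : g p = a 0%nat).
  { apply pseries_at_0. replace p with (p + 0)%C at 1 by ring. apply Ha.
    rewrite Cmod_0; exact hrho. }
  rewrite taylor_poly_leading in HT; [|lia|intros j hj; lia].
  replace (p + (y - p))%C with y in HT by ring.
  rewrite Cpow_1_r, <- h0 in HT.
  replace (g y - g p - (y - p) * a 1%nat)%C with (g y - (g p + a 1%nat * (y - p)))%C by ring.
  pose proof (Rlt_le_trans _ _ _ hy (Rmin_r _ _)) as hy'.
  apply (Rmult_lt_compat_r M) in hy'; [|lra].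
  replace (eps / M * M) with (pos eps) in hy' by (field; lra).
  pose proof (Cmod_ge_0 (y - p)). simpl in HT. nra.
Qed.

Lemma closed_disk_shrink (p : C) (t : R) :
  0 <= t <= 1 -> Cmod (p + RtoC (- t) * p) <= Cmod p.
Proof.
  intros ht. replace (p + RtoC (- t) * p)%C with (RtoC (1 - t) * p)%C
    by (rewrite RtoC_minus, RtoC_opp; ring).
  rewrite Cmod_mult, Cmod_R, Rabs_pos_eq by lra. pose proof (Cmod_ge_0 p). nra.
Qed.

Lemma local_pseries (U : C -> Prop) (g : C -> C) (p : C) :
  analytic_on_open U g -> U p ->
  exists rho a, 0 < rho /\ forall w, Cmod w < rho -> is_pseries a w (g (p + w)%C).
Proof.
  intros [_ Hg] hp. destruct (Hg p hp) as [rho [a [hrho Ha]]].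
  exists rho, a; split; [exact hrho|]. intros w hw.
  destruct (Ha (p + w)%C) as [_ H].
  - replace (p + w - p)%C with w by ring. exact hw.
  - replace (p + w - p)%C with w in H by ring. exact H.
Qed.

(** Two expansions agreeing on a segment issuing from the centre have the same
    linear term: subtracting the two first-order estimates gives
    [|a_1 - b_1| |w| = O(|w|^2)] along the segment. *)
Lemma pseries_first_coeff_radial (p : C) (a b : nat -> C) (ra rb : R) (F G : C -> C) :
  p <> RtoC 0 -> 0 < ra -> 0 < rb ->
  (forall w, Cmod w < ra -> is_pseries a w (F w)) ->
  (forall w, Cmod w < rb -> is_pseries b w (G w)) ->
  (forall t : R, 0 <= t <= 1 -> F (RtoC (- t) * p)%C = G (RtoC (- t) * p)%C) ->
  a 1%nat = b 1%nat.
Proof.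
  intros hp hra hrb HF HG Hagree.
  apply (proj1 (Cmod_gt_0 _)) in hp.
  assert (h0 : a 0%nat = b 0%nat).
  { rewrite <- (pseries_at_0 a (F (RtoC 0))), <- (pseries_at_0 b (G (RtoC 0))).
    - specialize (Hagree 0 ltac:(lra)).
      replace (RtoC (- 0) * p)%C with (RtoC 0) in Hagree by (rewrite Ropp_0; ring).
      exact Hagree.
    - apply HG; rewrite Cmod_0; lra.
    - apply HF; rewrite Cmod_0; lra. }
  destruct (taylor_remainder a ra F hra HF 1) as [M [d [hM [hd HT]]]].
  destruct (taylor_remainder b rb G hrb HG 1) as [N [e [hN [he HT']]]].
  apply Cmod_minus_small_eq; intros eps heps.
  set (m := Rmin (Rmin d e) (eps / (M + N))).
  assert (hm : 0 < m) by (repeat apply Rmin_pos; try lra; apply Rdiv_lt_0_compat; lra).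
  set (t := Rmin 1 (m / Cmod p / 2)).
  assert (hmp : 0 < m / Cmod p) by now apply Rdiv_lt_0_compat.
  assert (ht : 0 < t) by (apply Rmin_pos; lra).
  assert (ht1 : t <= 1) by apply Rmin_l.
  assert (htm : t <= m / Cmod p / 2) by apply Rmin_r.
  specialize (Hagree t ltac:(lra)).
  set (w := (RtoC (- t) * p)%C) in *.
  assert (hw : Cmod w = t * Cmod p)
    by (unfold w; rewrite Cmod_mult, Cmod_R, Rabs_Ropp, Rabs_pos_eq; lra).
  assert (hw0 : 0 < Cmod w) by (rewrite hw; now apply Rmult_lt_0_compat).
  assert (hwm : Cmod w < m).
  { rewrite hw. apply (Rmult_lt_reg_r (/ Cmod p)); [now apply Rinv_0_lt_compat|].
    rewrite Rmult_assoc, Rinv_r by lra. fold (Rdiv m (Cmod p)). lra. }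
  assert (m <= Rmin d e) by apply Rmin_l.
  assert (m <= eps / (M + N)) by apply Rmin_r.
  pose proof (Rmin_l d e). pose proof (Rmin_r d e).
  specialize (HT w ltac:(lra)). specialize (HT' w ltac:(lra)).
  rewrite taylor_poly_leading, Cpow_1_r in HT, HT'; try lia.
  rewrite Hagree, h0 in HT.
  assert (hq : Cmod (a 1%nat - b 1%nat) * Cmod w <= (M + N) * Cmod w * Cmod w).
  { rewrite <- Cmod_mult.
    replace ((a 1%nat - b 1%nat) * w)%C
      with (G w - (b 0%nat + b 1%nat * w) + - (G w - (b 0%nat + a 1%nat * w)))%C by ring.
    eapply Rle_trans; [apply Cmod_triangle|]. rewrite Cmod_opp.
    simpl in HT, HT'. lra. }
  apply Rmult_le_reg_r in hq; [|exact hw0].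
  assert (hlt : Cmod w < eps / (M + N)) by lra.
  apply (Rmult_lt_compat_r (M + N)) in hlt; [|lra].
  replace (eps / (M + N) * (M + N)) with eps in hlt by (field; lra). lra.
Qed.

(** The extension is not prescribed outside the disk, but any two of them agree
    on the radius through [p], and this already determines the derivative. *)
Lemma boundary_derive_in (f g : C -> C) (U : C -> Prop) (p : C) (a : nat -> C) (rho : R) :
  p <> RtoC 0 -> analytic_extension (closed_disk (Cmod p)) f U g -> 0 < rho ->
  (forall w, Cmod w < rho -> is_pseries a w (g (p + w)%C)) ->
  is_derive_in (closed_disk (Cmod p)) f p (a 1%nat).
Proof.
  intros hp Hg hrho Ha. split; [now exists U, g|].
  intros V h [HV [Hhf Hh]]. destruct Hg as [_ [Hgf _]].
  destruct (local_pseries V h p Hh) as [sigma [b [hsigma Hb]]].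
  { apply HV, Rle_refl. }
  replace (a 1%nat) with (b 1%nat); [now apply pseries_derive with sigma|].
  apply (pseries_first_coeff_radial p _ _ _ _ _ _ hp hsigma hrho Hb Ha).
  intros t ht. simpl.
  rewrite Hhf, Hgf; [reflexivity | |]; now apply closed_disk_shrink.
Qed.

(** * Extremal points of the modulus *)

(** The common form of the two cases: a one-sided control of [f z - f p] in the
    direction [c], which both kinds of extremum provide, excludes a critical
    point. *)
Lemma noncritical_of_one_sided (f : C -> C) (p c : C) :
  p <> RtoC 0 -> c <> RtoC 0 -> analytic_in (closed_disk (Cmod p)) f ->
  ~ constant_on (closed_disk (Cmod p)) f ->
  (forall z, closed_disk (Cmod p) z -> Re (c * (f z - f p)) <= Cmod (f z - f p) ^ 2) ->
  exists l, is_derive_in (closed_disk (Cmod p)) f p l /\ l <> RtoC 0.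
Proof.
  intros hp hc [U [g Hext]] hnc Hside.
  pose proof Hext as [HU [Hgf Hg]].
  assert (hpD : closed_disk (Cmod p) p) by apply Rle_refl.
  destruct (local_pseries U g p Hg (HU p hpD)) as [rho [a [hrho Ha]]].
  exists (a 1%nat). split; [now apply (boundary_derive_in f g U p a rho)|].
  intros ha1.
  assert (ha0 : f p = a 0%nat).
  { rewrite <- Hgf by exact hpD. apply pseries_at_0.
    replace p with (p + 0)%C at 1 by ring. apply Ha. rewrite Cmod_0; exact hrho. }
  destruct (constant_or_leading_term a rho (fun w => g (p + w)%C) hrho Ha)
    as [Hc | [k [M [d [hk [hak [hM [hd HT]]]]]]]].
  - apply hnc. exists (a 0%nat). intros z hz. rewrite <- Hgf by exact hz.
    replace z with (p + (z - p))%C by ring.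
    apply (identity_on_segment U g); [exact Hg | |].
    + intros t ht. apply HU. unfold closed_disk in *.
      replace (p + t * (z - p))%C with (RtoC (1 - t) * p + t * z)%C
        by (rewrite RtoC_minus; ring).
      eapply Rle_trans; [apply Cmod_triangle|].
      rewrite !Cmod_mult, !Cmod_R, !Rabs_pos_eq by lra. nra.
    + exists rho; split; [exact hrho|]. intros y hy.
      replace y with (p + (y - p))%C by ring. now apply Hc.
  - assert (hk2 : (2 <= k)%nat).
    { destruct (Nat.eq_dec k 1) as [->|]; [contradiction | lia]. }
    destruct (leading_term_escapes p (a k) c k M d (fun w => g (p + w)%C - a 0%nat)%C)
      as [w [hw Hw]]; auto.
    { intros w hw.
      replace (g (p + w) - a 0%nat - a k * w ^ k)%C
        with (g (p + w) - (a 0%nat + a k * w ^ k))%C by ring.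
      now apply HT. }
    specialize (Hside (p + w)%C hw).
    rewrite <- Hgf, ha0 in Hside by exact hw. simpl in *. lra.
Qed.

Lemma Cmod2_expand (u v : C) :
  Cmod v ^ 2 = Cmod u ^ 2 + 2 * Re (Cconj u * (v - u)) + Cmod (v - u) ^ 2.
Proof.
  rewrite !Cmod2_alt. destruct u as [u1 u2], v as [v1 v2]. simpl. ring.
Qed.

Theorem theorem5p2 (r : R) (hr : 0 < r) (f : C -> C)
    (hf : analytic_in (closed_disk r) f)
    (hnc : ~ constant_on (closed_disk r) f)
    (alpha : C) (halpha : Cmod alpha = r) :
  (is_max_point (closed_disk r) (fun z => Cmod (f z)) alpha ->
     exists l : C, is_derive_in (closed_disk r) f alpha l /\ l <> 0%C) /\
  (is_min_point (closed_disk r) (fun z => Cmod (f z)) alpha ->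
     f alpha = 0%C \/
     exists l : C, is_derive_in (closed_disk r) f alpha l /\ l <> 0%C).
Proof.
  subst r. apply (proj2 (Cmod_gt_0 _)) in hr.
  assert (hconj : f alpha <> 0%C -> Cconj (f alpha) <> 0%C).
  { intros h0 e. apply h0, Cmod_eq_0. now rewrite <- Cmod_conj, e, Cmod_0. }
  assert (hsq : forall u v : C, Cmod u <= Cmod v -> Cmod u ^ 2 <= Cmod v ^ 2).
  { intros u v h. apply pow_incr. split; [apply Cmod_ge_0 | exact h]. }
  split.
  - intros [_ Hmax].
    apply (noncritical_of_one_sided f alpha (Cconj (f alpha))); auto.
    + apply hconj. intros h0. apply hnc. exists 0%C. intros z hz.
      apply Cmod_eq_0, Rle_antisym; [|apply Cmod_ge_0].
      rewrite <- Cmod_0, <- h0. now apply Hmax.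
    + intros z hz. pose proof (hsq _ _ (Hmax z hz)) as h.
      rewrite (Cmod2_expand (f alpha) (f z)) in h.
      pose proof (pow2_ge_0 (Cmod (f z - f alpha))). lra.
  - intros [_ Hmin].
    destruct (classic (f alpha = 0%C)) as [h0|h0]; [now left | right].
    apply (noncritical_of_one_sided f alpha (- Cconj (f alpha))%C); auto.
    + intros e. apply (hconj h0).
      replace (Cconj (f alpha)) with (- - Cconj (f alpha))%C by ring. rewrite e. ring.
    + intros z hz. pose proof (hsq _ _ (Hmin z hz)) as h.
      rewrite (Cmod2_expand (f alpha) (f z)) in h.
      pose proof (pow2_ge_0 (Cmod (f z - f alpha))).
      replace (Re (- Cconj (f alpha) * (f z - f alpha)))
        with (- Re (Cconj (f alpha) * (f z - f alpha))) by (simpl; ring).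
      lra.
Qed.
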